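(* (Weak maximum principle) Let $\Omega$ be a bounded domain of $\mathbb R^n$. Let $u$ be upper semicontinuous on $\overline\Omega$. If $\mathcal M_{\mathbf a}(D^2u)\ge0$ in $\Omega$ in the viscosity sense for some $\mathcal M_{\mathbf a}\in\overline{\mathcal A}$, then $$\max_{\overline\Omega}u=\max_{\partial\Omega}u.$$ On the other hand, if $u$ is lower semicontinuous on $\overline\Omega$ and is a viscosity solution of the differential inequality $\mathcal M_{\mathbf a}(D^2u)\le0$ in $\Omega$ for some $\mathcal M_{\mathbf a}\in\overline{\mathcal A}$, then $$\min_{\overline\Omega}u=\min_{\partial\Omega}u.$$
   Context: For a real symmetric $n\times n$ matrix $X\in\mathcal S^n$, let $\lambda_1(X)\le\dots\le\lambda_n(X)$ be its eigenvalues. For $\mathbf a=(a_1,\dots,a_n)$ with $a_i\ge0$ for all $i$ and at least one $a_j>0$, set $\mathcal M_{\mathbf a}(X)=\sum_{i=1}^n a_i\lambda_i(X)$. $\overline{\mathcal A}$ is the class of all such operators. Viscosity notions: for an open set $\Omega$, an upper semicontinuous $u$ satisfies $\mathcal M_{\mathbf a}(D^2u)\ge0$ in $\Omega$ in the viscosity sense if $\mathcal M_{\mathbf a}(X)\ge0$ for all $x\in\Omega$ and all $(\xi,X)\in\mathbb R^n\times\mathcal S^n$ such that $u(y)\le u(x)+\langle\xi,y-x\rangle+\frac12\langle X(y-x),y-x\rangle+o(|y-x|^2)$ as $y\to x$. A lower semicontinuous $u$ satisfies $\mathcal M_{\mathbf a}(D^2u)\le0$ in the viscosity sense if $\mathcal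 M_{\mathbf a}(X)\le0$ for all $x\in\Omega$ and all $(\xi,X)$ such that $u(y)\ge u(x)+\langle\xi,y-x\rangle+\frac12\langle X(y-x),y-x\rangle+o(|y-x|^2)$ as $y\to x$. *)

(* Defs.v *)
From HB Require Import structures.
From mathcomp Require Import all_boot all_order all_algebra.
From mathcomp Require Import polyrcf.
From mathcomp Require Import all_classical all_reals all_analysis.

Set Implicit Arguments.
Unset Strict Implicit.
Unset Printing Implicit Defensive.

Import Order.TTheory GRing.Theory Num.Theory.
Import numFieldNormedType.Exports.

Local Open Scope classical_set_scope.
Local Open Scope ring_scope.

(* R^n is 'rV[R]_n, whose topology and bounded sets do not depend on the
   choice of norm; the library norm on 'rV[R]_n is the sup norm, so Euclidean
   lengths are written with the dot product. *)
Definition dot (R : realType) (n : nat) (x y : 'rV[R]_n) : R :=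
  (x *m y^T) 0 0.

Definition boundary (T : topologicalType) (A : set T) : set T :=
  closure A `\` A°.

(* connected set0 holds in the library, hence the nonemptiness clause. *)
Definition domain (T : topologicalType) (A : set T) : Prop :=
  [/\ open A, connected A & A !=set0].

(* Semicontinuity relative to A: in the topology of subspace A, the
   neighbourhoods of a point of A are its relative neighbourhoods, and points
   outside A are isolated, so that the values of u there are irrelevant. *)
Definition lsc_on (R : realType) (T : topologicalType) (A : set T)
    (u : T -> R) : Prop :=
  @lower_semicontinuous (subspace A) R (EFin \o u).

Definition usc_on (R : realType) (T : topologicalType) (A : set T)
    (u : T -> R) : Prop :=
  lsc_on A (fun x => - u x).

Definition is_max (R : realType) (A : set R) (m : R) : Prop :=
  A m /\ ubound A m.

Definition is_min (R : realType) (A : set R) (m : R) : Prop :=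
  A m /\ lbound A m.

(* rootsR p is strictly increasing and mup r p is the multiplicity of the root
   r, so this lists the real eigenvalues in nondecreasing order, repeated
   according to multiplicity; there are n of them when X is symmetric. *)
Definition eigenvalues (R : realType) (n : nat) (X : 'M[R]_n) : seq R :=
  flatten [seq nseq (mup r (char_poly X)) r | r <- rootsR (char_poly X)].

(* Indices are shifted: a i is a_(i+1), and the i-th entry of the list
   (counted from 0) is lambda_(i+1)(X). *)
Definition eigop (R : realType) (n : nat) (a : 'I_n -> R) (X : 'M[R]_n) : R :=
  \sum_(i < n) a i * (eigenvalues X)`_i.

Definition admissible (R : realType) (n : nat) (a : 'I_n -> R) : Prop :=
  (forall i, 0 <= a i) /\ (exists j, 0 < a j).

Definition Abar (R : realType) (n : nat) : set ('M[R]_n -> R) :=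
  [set eigop a | a in @admissible R n].
Arguments Abar : clear implicits.

(* For X symmetric, h *m X is X h written as a row vector. *)
Definition taylor2 (R : realType) (n : nat) (xi : 'rV[R]_n) (X : 'M[R]_n)
    (h : 'rV[R]_n) : R :=
  dot xi h + 2^-1 * dot (h *m X) h.

Definition superjet (R : realType) (n : nat) (u : 'rV[R]_n -> R)
    (x xi : 'rV[R]_n) (X : 'M[R]_n) : Prop :=
  exists2 r : 'rV[R]_n -> R,
    r =o_x (fun y => dot (y - x) (y - x)) &
    \forall y \near x, u y <= u x + taylor2 xi X (y - x) + r y.

Definition subjet (R : realType) (n : nat) (u : 'rV[R]_n -> R)
    (x xi : 'rV[R]_n) (X : 'M[R]_n) : Prop :=
  exists2 r : 'rV[R]_n -> R,
    r =o_x (fun y => dot (y - x) (y - x)) &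
    \forall y \near x, u y >= u x + taylor2 xi X (y - x) + r y.

Definition viscosity_ge0 (R : realType) (n : nat) (F : 'M[R]_n -> R)
    (Omega : set 'rV[R]_n) (u : 'rV[R]_n -> R) : Prop :=
  forall x, Omega x -> forall (xi : 'rV[R]_n) (X : 'M[R]_n),
    X \is symmetricmx -> superjet u x xi X -> 0 <= F X.

Definition viscosity_le0 (R : realType) (n : nat) (F : 'M[R]_n -> R)
    (Omega : set 'rV[R]_n) (u : 'rV[R]_n -> R) : Prop :=
  forall x, Omega x -> forall (xi : 'rV[R]_n) (X : 'M[R]_n),
    X \is symmetricmx -> subjet u x xi X -> F X <= 0.

(* Main.v *)
Require Import Defs.
From mathcomp Require Import all_boot all_order all_algebra.
From mathcomp Require Import polyrcf.
From mathcomp Require Import all_classical all_reals all_analysis.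
From mathcomp Require Import ring lra.

Set Implicit Arguments.
Unset Strict Implicit.
Unset Printing Implicit Defensive.

Import Order.TTheory GRing.Theory Num.Theory.
Import numFieldNormedType.Exports.

Local Open Scope classical_set_scope.
Local Open Scope ring_scope.

(** The principle holds because a point where a small paraboloid touches [u]
    from above carries a superjet whose matrix is a negative multiple of the
    identity, and [M_a] is negative there. For [e > 0] the function
    [u y + e |y|^2] attains its maximum over the compact set [closure Omega] at
    some [z]. If [z] were in the open set [Omega], then expanding [|y|^2]
    around [z] would put [(- 2 e z, - 2 e I)] in the superjet of [u] at [z]
    ([superjet_of_local_max]), whereas all eigenvalues of [- 2 e I] are
    [- 2 e], so that [M_a (- 2 e I) = - 2 e (a_1 + ... + a_n) < 0]
    ([eigop_scalar], [admissible_sum_gt0]). So [z] lies on the boundary, and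
    for every [y] in [closure Omega]
    [u y <= u y + e |y|^2 <= u z + e |z|^2 <= max_boundary u + e C],
    with [C] a bound of [|.|^2] on [closure Omega]; let [e] tend to [0]
    ([weak_max_principle]).

    The existence of [z] also shows that the boundary is nonempty, which the
    maximum over the boundary requires.

    The statement on minima follows by applying the same lemma to [- u], since
    a superjet of [- u] is the opposite of a subjet of [u] ([superjetN]). *)

(** * Eigenvalues of scalar matrices *)

Lemma rootsR_XsubC_exp (R : rcfType) (c : R) (n : nat) :
  (0 < n)%N -> rootsR (('X - c%:P) ^+ n) = [:: c].
Proof.
case: n => // n _; set p := _ ^+ _.
have p0 : p != 0 by rewrite expf_neq0 // polyXsubC_eq0.
apply: perm_small_eq => //; apply: uniq_perm => //; first exact: uniq_roots.
move=> x; have /(_ x) := roots_on_rootsR p0.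
by rewrite root_exp_XsubC !in_itv /= inE.
Qed.

Lemma eigenvalues_scalar (R : realType) (n : nat) (c : R) :
  (0 < n)%N -> eigenvalues (c%:M : 'M[R]_n) = nseq n c.
Proof.
move=> n_gt0; rewrite /eigenvalues char_poly_trig ?scalar_mx_is_trig //.
under eq_bigr do rewrite mxE eqxx mulr1n.
by rewrite prodr_const card_ord rootsR_XsubC_exp //= cats0 mup_XsubCX eqxx.
Qed.

Lemma eigop_scalar (R : realType) (n : nat) (a : 'I_n -> R) (c : R) :
  eigop a c%:M = (\sum_(i < n) a i) * c.
Proof.
rewrite /eigop mulr_suml; apply: eq_bigr => i _.
by rewrite eigenvalues_scalar ?(leq_trans _ (ltn_ord i)) // nth_nseq ltn_ord.
Qed.

Lemma admissible_sum_gt0 (R : realType) (n : nat) (a : 'I_n -> R) :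
  admissible a -> 0 < \sum_(i < n) a i.
Proof.
case=> a_ge0 [j aj_gt0]; rewrite (bigD1 j) //=.
by rewrite ltr_pwDl // sumr_ge0.
Qed.

(** * Semicontinuous functions on compact sets *)

(** Off [A] the subspace topology is discrete, so the condition there is void:
    semicontinuity on [A] only speaks of relative neighbourhoods. *)
Lemma lsc_onP (R : realType) (T : topologicalType) (A : set T) (u : T -> R) :
  lsc_on A u <->
  forall x, A x -> forall a, a < u x -> \forall y \near x, A y -> a < u y.
Proof.
split=> [lscu x Ax a aux|lscu x a aux].
  have [|V] := lscu x a; first by rewrite /= lte_fin.
  case: (@nbhs_subspaceP T A x) => // _ VA aV.
  move: VA; rewrite /within /=; apply: filterS => y AV Ay.
  by have := aV _ (AV Ay); rewrite /= lte_fin.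
exists [set y | a < u y]; first last.
  by move=> y; rewrite /= lte_fin.
case: (@nbhs_subspaceP T A x) => [Ax|nAx]; last by move=> y ->.
by apply: lscu; rewrite // -lte_fin.
Qed.

Lemma lsc_on_subset (R : realType) (T : topologicalType) (A B : set T)
    (u : T -> R) :
  B `<=` A -> lsc_on A u -> lsc_on B u.
Proof.
move=> BA /lsc_onP lscu; apply/lsc_onP => x /BA Ax a /(lscu x Ax).
by apply: filterS => y ? /BA.
Qed.

Lemma continuous_lsc_on (R : realType) (T : topologicalType) (A : set T)
    (g : T -> R) :
  continuous g -> lsc_on A g.
Proof.
move=> cg; apply/lsc_onP => x _ a ax.
have : \forall y \near x, a < g y by apply: (cvgr_gt _ (cg x)).
by apply: filterS.
Qed.

Lemma lsc_onD (R : realType) (T : topologicalType) (A : set T) (u g : T -> R) :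
  lsc_on A u -> continuous g -> lsc_on A (fun x => u x + g x).
Proof.
move=> /lsc_onP lscu cg; apply/lsc_onP => x Ax a aux.
pose d := (u x + g x - a) / 2.
have d_gt0 : 0 < d by rewrite /d divr_gt0 // subr_gt0.
have /(lscu x Ax) : u x - d < u x by lra.
have gx : \forall y \near x, g x - d < g y.
  by apply: (cvgr_gt _ (cg x)); rewrite gtrBl.
apply: filterS2 gx => y gy uy Ay; have := uy Ay.
by rewrite /d in gy *; lra.
Qed.

(** The sublevel sets of [u] at its values on [A] form a chain of nonempty sets,
    hence a filter base; by compactness it clusters at some [x] of [A]. A value
    of [u] on [A] below [u x] would, by semicontinuity, exclude its own sublevel
    set from a neighbourhood of [x]. *)
Lemma lsc_on_compact_min (R : realType) (T : topologicalType) (A : set T)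
    (u : T -> R) :
  compact A -> A !=set0 -> lsc_on A u ->
  exists2 x, A x & forall y, A y -> u x <= u y.
Proof.
move=> cA [x0 Ax0] /lsc_onP lscu.
pose F := filter_from A (fun y => [set z | A z /\ u z <= u y]).
have FF : ProperFilter F.
  apply: filter_from_proper; last by move=> y Ay; exists y; split.
  apply: filter_from_filter; first by exists x0.
  move=> y z Ay Az; case: (leP (u y) (u z)) => [yz|/ltW zy].
    by exists y => // t [At ty]; do !split=> //; exact: le_trans yz.
  by exists z => // t [At tz]; do !split=> //; exact: le_trans zy.
have [|x [Ax clx]] := cA F FF; first by exists x0 => // z [].
exists x => // y Ay; rewrite leNgt; apply/negP => yx.
have Fy : F [set z | A z /\ u z <= u y] by exists y.
have [z [[Az zy] /(_ Az)]] := clx _ _ Fy (lscu x Ax _ yx).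
by rewrite ltNge zy.
Qed.

(** * The squared Euclidean length *)

Section dot_product.
Context {R : realType} {n : nat}.
Implicit Types x y h : 'rV[R]_n.

Lemma dotE x y : dot x y = \sum_i x 0 i * y 0 i.
Proof. by rewrite /dot mxE; apply: eq_bigr => i _; rewrite mxE. Qed.

Lemma dot_ge0 x : 0 <= dot x x.
Proof. by rewrite dotE sumr_ge0 // => i _; rewrite -expr2 sqr_ge0. Qed.

Lemma dotNl x y : dot (- x) y = - dot x y.
Proof. by rewrite /dot mulNmx mxE. Qed.

Lemma dotZl c x y : dot (c *: x) y = c * dot x y.
Proof. by rewrite /dot -scalemxAl mxE. Qed.

(** This is the exact second-order Taylor expansion at [z] of the squared
    length: its gradient is [2 z] and its Hessian twice the identity. *)
Lemma dot_shift z y :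
  dot y y = dot z z + 2 * dot z (y - z) + dot (y - z) (y - z).
Proof.
rewrite !dotE mulr_sumr -!big_split /=; apply: eq_bigr => i _.
by rewrite !mxE; ring.
Qed.

Lemma taylor2_scalar xi c h :
  taylor2 xi c%:M h = dot xi h + 2^-1 * (c * dot h h).
Proof. by rewrite /taylor2 mul_mx_scalar dotZl. Qed.

Lemma taylor2N xi X h : taylor2 (- xi) (- X) h = - taylor2 xi X h.
Proof. by rewrite /taylor2 mulmxN !dotNl mulrN opprD. Qed.

Lemma dot_continuous : continuous (fun x : 'rV[R]_n => dot x x).
Proof.
rewrite (_ : (fun x => _) = fun x => \sum_i x 0 i * x 0 i); last first.
  by apply/funext => y; rewrite dotE.
apply: continuous_big => [|i _ x]; first exact: add_continuous.
by apply: (@cvgM _ _ (nbhs x)); exact: coord_continuous.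
Qed.

Lemma scale_dot_continuous c : continuous (fun x : 'rV[R]_n => c * dot x x).
Proof.
move=> x; apply: (@cvgM _ _ (nbhs x) _ (cst c)); first exact: cvg_cst.
exact: dot_continuous.
Qed.

End dot_product.

(** Closed balls are closed, so a bound on [A] passes to its closure. *)
Lemma bounded_set_closure (R : realType) (n : nat) (A : set 'rV[R]_n) :
  bounded_set A -> bounded_set (closure A).
Proof.
move=> [M [Mreal AM]]; exists M; split => // x Mx.
have AB : A `<=` closed_ball_ Num.norm 0 x.
  by move=> y /(AM _ Mx); rewrite /closed_ball_ /= sub0r normrN.
move=> y /(closure_subset AB).
have /closure_id <- : closed (closed_ball_ Num.norm (0 : 'rV[R]_n) x).
  exact: closed_closed_ball_.
by rewrite /closed_ball_ /= sub0r normrN.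
Qed.

(** * Jets, and the maximum principle *)

Lemma scalar_mx_symmetric (R : realType) (n : nat) (c : R) :
  (c%:M : 'M[R]_n) \is symmetricmx.
Proof.
by apply/is_hermitianmxP; rewrite expr0 scale1r map_mx_id // tr_scalar_mx.
Qed.

(** Touching [u] from above by a paraboloid gives a jet without error term, as
    the Taylor expansion of the squared length is exact. *)
Lemma superjet_of_local_max (R : realType) (n : nat) (u : 'rV[R]_n -> R)
    (e : R) (z : 'rV[R]_n) :
  (\forall y \near z, u y + e * dot y y <= u z + e * dot z z) ->
  superjet u z (- (2 * e) *: z) (- (2 * e))%:M.
Proof.
move=> zmax; exists (fun=> 0).
  by apply/eqoP => _/posnumP[d]; near=> y; rewrite normr0 mulr_ge0.
apply: filterS zmax => y; rewrite addr0 taylor2_scalar dotZl (dot_shift z y).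
by lra.
Unshelve. all: by end_near. Qed.

Lemma superjetN (R : realType) (n : nat) (u : 'rV[R]_n -> R) x xi X :
  superjet (fun y => - u y) x xi X -> subjet u x (- xi) (- X).
Proof.
case=> r ro near_u; exists (fun y => - r y).
  apply/eqoP => d d_gt0; move/eqoP: ro => /(_ d d_gt0).
  by apply: filterS => y; rewrite normrN.
by apply: filterS near_u => y; rewrite taylor2N; lra.
Qed.

(** The operator enters only through the absence of superjets with a negative
    scalar matrix: this lets the statements on maxima and on minima share one
    proof. *)
Lemma weak_max_principle (R : realType) (n : nat) (Omega : set 'rV[R]_n)
    (u : 'rV[R]_n -> R) :
  open Omega -> Omega !=set0 -> bounded_set Omega ->
  usc_on (closure Omega) u ->
  (forall e x xi, 0 < e -> Omega x -> ~ superjet u x xi (- e)%:M) ->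
  exists m, is_max (u @` closure Omega) m /\ is_max (u @` boundary Omega) m.
Proof.
move=> Oop [x0 Ox0] Obd uscu nojet.
set C := closure Omega.
have Ccpt : compact C.
  apply: bounded_closed_compact; first exact: bounded_set_closure.
  exact: closed_closure.
have Cn0 : C !=set0 by exists x0; exact: subset_closure.
(* A maximizer in the open set Omega would be a local maximum there, hence
   yield one of the excluded jets. *)
have pert e : 0 < e -> exists2 z, boundary Omega z &
    forall y, C y -> u y + e * dot y y <= u z + e * dot z z.
  move=> e_gt0.
  have [z Cz zmax] := lsc_on_compact_min Ccpt Cn0
    (lsc_onD uscu (@scale_dot_continuous _ _ (- e))).
  have {}zmax y : C y -> u y + e * dot y y <= u z + e * dot z z.
    by move=> /zmax; lra.
  exists z => //; split => // /interior_subset Oz.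
  apply: (nojet (2 * e) z (- (2 * e) *: z)) => //; first by rewrite mulr_gt0.
  apply: superjet_of_local_max; apply: filterS (open_nbhs_nbhs (conj Oop Oz)).
  by move=> y Oy; apply: zmax; exact: subset_closure.
have [w Cw wmax] : exists2 w, C w & forall y, C y -> dot y y <= dot w w.
  have [w Cw wmin] := lsc_on_compact_min Ccpt Cn0
    (continuous_lsc_on (@scale_dot_continuous _ _ (- 1))).
  by exists w => // y /wmin; rewrite !mulN1r lerN2.
have bC : boundary Omega `<=` C by move=> x [].
have [b Bb bmax] : exists2 b, boundary Omega b &
    forall y, boundary Omega y -> u y <= u b.
  have [||b Bb bmin] := lsc_on_compact_min _ _ (lsc_on_subset bC uscu).
  - apply: (subclosed_compact _ Ccpt) => //; rewrite /boundary setDE.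
    apply: closedI; first exact: closed_closure.
    by apply: open_closedC; exact: open_interior.
  - by have [z Bz _] := pert 1 ltr01; exists z.
  by exists b => // y /bmin; rewrite lerN2.
have uleb y : C y -> u y <= u b.
  move=> Cy; apply/ler_addgt0Pr => d d_gt0.
  have w1_gt0 : 0 < dot w w + 1 by rewrite ltr_wpDl ?dot_ge0.
  (* This choice makes the perturbation e |z|^2 at most d; adding 1 makes
     the denominator positive. *)
  pose e := d / (dot w w + 1).
  have e_gt0 : 0 < e by rewrite divr_gt0.
  have [z Bz /(_ y Cy) yz] := pert e e_gt0.
  have ed : e * (dot w w + 1) = d by rewrite divfK // gt_eqF.
  have ey : 0 <= e * dot y y by rewrite mulr_ge0 ?dot_ge0 ?ltW.
  have ez : e * dot z z <= e * dot w w.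
    by rewrite ler_pM2l //; apply: wmax; exact: bC.
  by have := bmax z Bz; lra.
exists (u b); split; split; [exists b|..] => //; [exact: bC|..].
- by move=> _ [y Cy <-]; exact: uleb.
- by move=> _ [y By <-]; exact: bmax.
Qed.

Theorem corollary3p2 (R : realType) (n : nat) (Omega : set 'rV[R]_n)
    (Omega_domain : domain Omega) (Omega_bounded : bounded_set Omega) :
  (forall u : 'rV[R]_n -> R,
     usc_on (closure Omega) u ->
     (exists2 M, Abar R n M & viscosity_ge0 M Omega u) ->
     exists m, is_max (u @` closure Omega) m /\
               is_max (u @` boundary Omega) m) /\
  (forall u : 'rV[R]_n -> R,
     lsc_on (closure Omega) u ->
     (exists2 M, Abar R n M & viscosity_le0 M Omega u) ->
     exists m, is_min (u @` closure Omega) m /\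
               is_min (u @` boundary Omega) m).
Proof.
have [Oop _ On0] := Omega_domain; split=> u.
  move=> uscu [_ [a /admissible_sum_gt0 a_gt0 <-] visc].
  apply: weak_max_principle => // e x xi e_gt0 Ox jet.
  have := visc x Ox xi _ (scalar_mx_symmetric _ _) jet.
  by rewrite eigop_scalar mulrN oppr_ge0 leNgt mulr_gt0.
move=> lscu [_ [a /admissible_sum_gt0 a_gt0 <-] visc].
have [|e x xi e_gt0 Ox|m] :=
  @weak_max_principle _ _ _ (fun x => - u x) Oop On0 Omega_bounded.
- by rewrite /usc_on; under eq_fun do rewrite opprK.
- move=> /superjetN; rewrite -raddfN opprK => jet.
  have := visc x Ox _ _ (scalar_mx_symmetric _ _) jet.
  by rewrite eigop_scalar leNgt mulr_gt0.
have maxN A : is_max ((fun x => - u x) @` A) m -> is_min (u @` A) (- m).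
  case=> [[x Ax <-] ub]; split; first by exists x; rewrite ?opprK.
  by move=> _ [y Ay <-]; rewrite lerNl; apply: ub; exists y.
by case=> /maxN ? /maxN ?; exists (- m).
Qed.
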